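(* Let $k\ge 3$ and let $\{G_n\}_{n=1}^\infty$ be a sequence of finite connected simple $k$-regular graphs with $g(G_n)\to\infty$ as $n\to\infty$, for which there is a constant $c>0$, independent of $n$, such that $g(G_n)\ge c\,\mathrm{diam}(G_n)$ for all $n$. For each $n$ pick a spanning tree $T_n$ of $G_n$, and let $\widetilde G_n$ be the lift of $G_n$ determined by $T_n$ as defined in the context. Then $c_1(\widetilde G_n)=O(1)$; that is, there is a constant $D<\infty$ such that $c_1(\widetilde G_n)\le D$ for all $n$.
   Context: All graphs are endowed with their shortest path distance. $g(G)$ is the girth of $G$ (the length of a shortest cycle in $G$) and $\mathrm{diam}(G)$ is the diameter of $G$. The lift: let $G$ be a finite connected simple graph with a chosen spanning tree $T$, let $S=E(G)\setminus E(T)$, and let $L=\{0,1\}^S$ be the set of all $\{0,1\}$-valued functions on $S$. The graph $\widetilde G$ has vertex set $V(\widetilde G)=V(G)\times L$. Its edge set is the union, over edges $e=uv\in E(G)$, of the following perfect matchings between $\{u\}\times L$ and $\{v\}\times L$: if $e\in E(T)$, then $(u,f)$ is matched with $(v,f)$ for every $f\in L$; if $e\in S$, then $(u,f)$ is matched with $(v,h)$ for every $f\in L$, where $h\in L$ has the same values as $f$ on $S\setminus\{e\}$ and $h(e)=1-f(e)$. Distortion: for a map $f:X\to Y$ between metric spaces, the distortion of $f$ is the smallest $C$ for which there is $r>0$ with $r\,d_X(u,v)\le d_Y(f(u),f(v))\le rC\,d_X(u,v)$ for all $u,v\in X$. For a finite metric space $X$, $c_1(X)$ denotes the infimum of distortions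 of all embeddings of $X$ into the Banach space $\ell_1$. Here $c_1(\widetilde G_n)$ is $c_1$ of the vertex set $V(\widetilde G_n)$ with its shortest path distance. *)

(* Defs.v *)
From mathcomp Require Import all_boot all_order all_algebra.
From mathcomp Require Import all_classical all_reals all_analysis.

Set Implicit Arguments.
Unset Strict Implicit.
Unset Printing Implicit Defensive.

Import Order.TTheory GRing.Theory Num.Theory.
Import numFieldNormedType.Exports.

Record sgraph := SGraph {
  vertex :> finType;
  adj : rel vertex;
  adj_sym : symmetric adj;
  adj_irrefl : irreflexive adj
}.

Section Graphs.
Variable G : sgraph.
Implicit Types (x y : G) (p : seq G).

Definition edges : {set {set G}} :=
  [set e | [exists x, exists y, adj x y && (e == [set x; y])]].

(* The empty graph does not count as connected. *)
Definition gconnected : Prop :=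
  (0 < #|G|)%N /\ forall x y, connect (@adj G) x y.

Definition regular (k : nat) : Prop := forall x, #|[set y : G | adj x y]%SET| = k.

(* A cycle of length [size p], listed without repeating its starting vertex. *)
Definition is_cycle p : bool := (2 < size p)%N && ucycleb (@adj G) p.

Definition is_tree : Prop := gconnected /\ forall p, ~~ is_cycle p.

(* The least length of a walk from [x] to [y]; a shortest walk has fewer than
   #|G| edges, and #|G| is the default value when [y] is unreachable. *)
Definition gdist x y : nat :=
  find (fun n => [exists p : n.-tuple G, path (@adj G) x p && (last x p == y)])
       (iota 0 #|G|).

Definition diam : nat := \max_(x : G) \max_(y : G) gdist x y.

(* The least length of a cycle; cycles have at most #|G| vertices, and
   #|G|.+1 is the default value when there is no cycle. *)
Definition girth : nat :=
  find (fun n => [exists p : n.-tuple G, is_cycle p]) (iota 0 #|G|.+1).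

End Graphs.

Section Lift.
Variables (G : sgraph) (T : {set {set G}}).

Definition span_adj : rel G := fun u v => adj u v && ([set u; v] \in T).

Lemma span_adj_sym : symmetric span_adj.
Proof. by move=> u v; rewrite /span_adj adj_sym finset.setUC. Qed.

Lemma span_adj_irrefl : irreflexive span_adj.
Proof. by move=> u; rewrite /span_adj adj_irrefl. Qed.

Definition spanning_subgraph : sgraph := SGraph span_adj_sym span_adj_irrefl.

Definition spanning_tree : Prop :=
  T \subset edges G /\ is_tree spanning_subgraph.

Definition cotree : {set {set G}} := edges G :\: T.

Definition labeling := {ffun {e : {set G} | e \in cotree} -> bool}.

Definition lift_adj : rel (G * labeling) := fun a b =>
  adj a.1 b.1 &&
  if [set a.1; b.1] \in T then a.2 == b.2
  else [forall s, b.2 s == (if val s == [set a.1; b.1] then ~~ a.2 s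
                            else a.2 s)].

Lemma lift_adj_sym : symmetric lift_adj.
Proof.
have half a b : lift_adj a b -> lift_adj b a.
  rewrite /lift_adj adj_sym => /andP[-> /=].
  rewrite [[set b.1; _]%SET]finset.setUC.
  case: ifP => _; first by rewrite eq_sym.
  move=> /forallP h; apply/forallP => s; rewrite (eqP (h s)).
  by case: (sval s == _); rewrite ?negbK eqxx.
by move=> a b; apply/idP/idP; exact: half.
Qed.

Lemma lift_adj_irrefl : irreflexive lift_adj.
Proof. by move=> a; rewrite /lift_adj adj_irrefl. Qed.

Definition lift_graph : sgraph := SGraph lift_adj_sym lift_adj_irrefl.

End Lift.

Local Open Scope classical_set_scope.
Local Open Scope ring_scope.

Section Distortion.
Context {R : realType}.

Definition ell1 := {u : R^nat | cvgn [normed series u]}.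

Definition ell1_dist (u v : ell1) : R :=
  limn [normed series (fun k => sval u k - sval v k)].

(* Extended-real valued: it is +oo when no [C] is admissible. *)
Definition distortion (X Y : Type) (dX : X -> X -> R) (dY : Y -> Y -> R)
    (f : X -> Y) : \bar R :=
  ereal_inf [set C%:E | C in [set C : R | exists2 r : R, 0 < r &
    forall u v, r * dX u v <= dY (f u) (f v) <= r * C * dX u v]].

Definition c1 (X : Type) (dX : X -> X -> R) : \bar R :=
  ereal_inf [set distortion dX ell1_dist f | f in
    [set f : X -> ell1 | injective f]].

End Distortion.

Definition c1_graph (R : realType) (G : sgraph) : \bar R :=
  c1 (fun x y : G => (gdist x y)%:R : R).

(* Main.v *)
Require Import Defs.
From mathcomp Require Import all_boot all_order all_algebra.
From mathcomp Require Import all_classical all_reals all_analysis.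
From mathcomp Require Import lra.

Set Implicit Arguments.
Unset Strict Implicit.
Unset Printing Implicit Defensive.

Import Order.TTheory GRing.Theory Num.Theory.
Import numFieldNormedType.Exports.

(** The lift carries one wall for each edge [e] of the base graph [G]: deleting
the edges of the lift that lie over [e] leaves two sides, because a walk in the
lift can return to its starting point only if its projection to [G] uses [e] an
even number of times.  Let [A(x, y)] be the set of edges of [G] whose wall
separates [x] from [y] ([separating]).  Sending [x] to the vector of its sides
maps the lift to a finite-dimensional cube, hence to [ell1], and the distance of
the images is [#|A(x, y)|].  The theorem follows from
[[
    #|A(x, y)| <= d(x, y) <= (1 + 2 / c) * #|A(x, y)|,
]]
where [c * diam G <= girth G]; the distortion is at most [1 + 2 / c].

The left inequality holds because every step of a walk crosses one wall
([card_separating_le]).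

For the right one, let [u] and [v] be the projections of [x] and [y].  A walk
from [x] projects to a walk from [u]; conversely a walk in [G] from [u] to [v]
lifts to a walk that ends at [y] precisely when the set of edges it uses an odd
number of times is [A(x, y)].  So one needs a short walk in [G] from [u] to [v]
with prescribed odd edges [A], knowing that the mod 2 boundary of [A] is
[u + v] ([walk_of_boundary]).  It is built by induction on [#|A|].  If [u] and
[v] differ, then [u] has odd degree in [A], so the walk can start along an edge
of [A], which is removed from [A] at the price of one step.  If [u = v], then
all degrees in [A] are even, so [A] is empty or contains a simple cycle [C].
Going from [u] to [C], once around it and back by the same way costs at most
[2 * diam G + #|C|] and removes [C] from [A]; since [C] has at least
[girth G >= c * diam G] edges, the price is at most [1 + 2 / c] for each edge
removed.

That walls exist for the edges of the spanning tree too is shown by the explicit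
formula [wall]; that the boundary of [A(x, y)] is [u + v] follows from the
connectedness of the lift ([lift_connected]), since [A(x, y)] is then the set of
odd edges of some walk from [u] to [v]. *)

(** * Walks, distance, girth and cycles *)

Section Walks.
Variable G : sgraph.
Implicit Types (u v w : G) (p q : seq G) (A : {set {set G}}).

Lemma gdist_walk u v : connect (@adj G) u v ->
  exists p, [/\ path (@adj G) u p, last u p = v & size p = gdist u v].
Proof.
move=> /connectP[p0 /shortenP[p pp up _] ->].
have ltp : size p < #|G|.
  by have /card_uniqP/= <- := up; rewrite max_card.
have hasP : has (fun n => [exists q : n.-tuple G,
    path (@adj G) u q && (last u q == last u p)]) (iota 0 #|G|).
  apply/hasP; exists (size p); first by rewrite mem_iota.
  by apply/existsP; exists (in_tuple p); rewrite /= pp eqxx.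
have := nth_find 0 hasP; rewrite nth_iota ?add0n; last first.
  by rewrite -[X in _ < X](size_iota 0) -has_find.
by move=> /existsP[q /andP[qp /eqP ql]]; exists q; rewrite size_tuple.
Qed.

Lemma gdist_le_walk u p : path (@adj G) u p -> gdist u (last u p) <= size p.
Proof.
move=> pp; rewrite leqNgt; apply/negP => lt.
have := before_find 0 lt; rewrite nth_iota ?add0n.
  by move=> /existsP[]; exists (in_tuple p); rewrite /= pp eqxx.
by apply: leq_trans lt _; rewrite -[X in _ <= X](size_iota 0) find_size.
Qed.

Lemma gdist_le_diam u v : gdist u v <= diam G.
Proof.
apply: leq_trans (leq_bigmax (F := fun x => \max_(y : G) gdist x y) u).
exact: (leq_bigmax (F := gdist u) v).
Qed.

Lemma girth_le_cycle p : is_cycle p -> girth G <= size p.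
Proof.
move=> cp; rewrite leqNgt; apply/negP => lt.
have := before_find 0 lt; rewrite nth_iota ?add0n.
  by move=> /existsP[]; exists (in_tuple p).
by apply: leq_trans lt _; rewrite -[X in _ <= X](size_iota 0) find_size.
Qed.

(** Consider a longest simple path, starting at [u].  Its first vertex has a second
neighbour, which lies on the path by maximality and so closes a cycle. *)
Lemma cycle_of_no_leaf u0 v0 : adj u0 v0 ->
  (forall u v, adj u v -> exists2 w, w != v & adj u w) ->
  exists p : seq G, is_cycle p.
Proof.
move=> uv0 noleaf.
pose P n := [exists p : n.-tuple G, [&& 1 < n, sorted (@adj G) p & uniq p]].
have exP : exists n, P n.
  exists 2; apply/existsP; exists [tuple u0; v0] => /=.
  rewrite uv0 inE /= andbT.
  by apply: contraTneq uv0 => ->; rewrite adj_irrefl.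
have ubP n : P n -> n <= #|G|.
  move=> /existsP[p /and3P[_ _ /card_uniqP]].
  by rewrite size_tuple => <-; exact: max_card.
case: (ex_maxnP exP ubP) => n /existsP[[s /= /eqP <-]].
case: s => [|u [|v p]] // /and3P[_ /andP[uv]].
rewrite -/(path _ v p) => vp upq maxn.
have {}upq : uniq [:: u, v & p] := upq.
have [w wv uw] := noleaf u v uv.
have [win|wnin] := boolP (w \in u :: v :: p); last first.
  have /maxn : P (size p).+3.
    apply/existsP; exists (in_tuple [:: w, u, v & p]).
    apply/and3P; split=> //; first by apply/and3P; split; rewrite // adj_sym.
    by rewrite [uniq _]cons_uniq wnin.
  by rewrite ltnn.
have wu : w != u by apply: contraTneq uw => ->; rewrite adj_irrefl.
move: win; rewrite !inE (negPf wu) (negPf wv) /= => win.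
case/splitPr: win vp upq => p1 p2.
rewrite cat_path => /andP[vp1 /= /andP[lw _]].
rewrite -cat_rcons => upq.
have {upq}: uniq ([:: u, v & rcons p1 w] ++ p2) := upq.
rewrite cat_uniq => /andP[up1 _].
exists [:: u, v & rcons p1 w].
rewrite /is_cycle /ucycleb up1 /= size_rcons andbT /=.
by rewrite uv !rcons_path vp1 last_rcons lw adj_sym uw.
Qed.

(** * Odd edges of a walk and boundaries modulo 2 *)

Definition walk_edges u p : seq {set G} := pairmap (fun a b => [set a; b]) u p.

(** The class of the walk in the space of 1-chains of [G] modulo 2. *)
Definition odd_edges u p : {set {set G}} :=
  [set e | odd (count_mem e (walk_edges u p))].

Lemma adj_edges u v : adj u v -> [set u; v] \in edges G.
Proof.
move=> uv; rewrite inE; apply/existsP; exists u.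
by apply/existsP; exists v; rewrite uv eqxx.
Qed.

Lemma edges_inv e u : e \in edges G -> u \in e ->
  exists2 v, adj u v & e = [set u; v].
Proof.
rewrite inE => /existsP[a /existsP[b /andP[ab /eqP ->]]].
rewrite !inE => /orP[/eqP->|/eqP->]; first by exists b.
by exists a; [rewrite adj_sym | rewrite finset.setUC].
Qed.

Lemma walk_edges_sub u p : path (@adj G) u p ->
  {subset walk_edges u p <= edges G}.
Proof.
elim: p u => [|v p IH] u //= /andP[uv vp] e.
by rewrite inE => /orP[/eqP->|/IH->//]; exact: adj_edges.
Qed.

Lemma walk_edges_vertex u p e w : e \in walk_edges u p -> w \in e -> w \in u :: p.
Proof.
elim: p u => [|v p IH] u //=; rewrite inE => /orP[/eqP->|he we].
  by rewrite !inE orbA => ->.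
by rewrite inE (IH _ he we) orbT.
Qed.

Lemma walk_edges_uniq u p : uniq (u :: p) -> uniq (walk_edges u p).
Proof.
elim: p u => [|v p IH] u //= /andP[nu uvp].
rewrite IH // andbT; apply: contra nu => /walk_edges_vertex; apply.
by rewrite !inE eqxx.
Qed.

(** Simple closed walks of length 2 run twice through one edge, hence the bound on
the size. *)
Lemma cycle_edges_uniq u p : 1 < size p -> uniq (u :: p) ->
  uniq (walk_edges u (rcons p u)).
Proof.
case: p => [|v [|w p]] // _ upq.
have uq : uniq (v :: w :: rcons p u).
  by rewrite -!rcons_cons rcons_uniq -cons_uniq.
rewrite -[walk_edges _ _]/([set u; v] :: walk_edges v (w :: rcons p u)) cons_uniq.
rewrite walk_edges_uniq // andbT.
rewrite -[walk_edges _ _]/([set v; w] :: walk_edges w (rcons p u)).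
rewrite inE negb_or; apply/andP; split.
  have : u \notin [set v; w].
    by move: upq; rewrite /= !inE !negb_or => /and3P[/and3P[-> ->]].
  by apply: contraNneq => <-; rewrite !inE eqxx.
move: uq; rewrite cons_uniq => /andP[+ _]; apply: contra => /walk_edges_vertex; apply.
by rewrite !inE eqxx orbT.
Qed.

Lemma walk_edges_rev u p :
  walk_edges (last u p) (rev (belast u p)) = rev (walk_edges u p).
Proof.
elim: p u => [|v p IH] u //=.
rewrite !rev_cons -cats1 /walk_edges pairmap_cat -!/(walk_edges _ _) IH /=.
have -> : last (last v p) (rev (belast v p)) = v.
  rewrite -[LHS]/(last v (last v p :: rev (belast v p))).
  by rewrite -rev_rcons -lastI rev_cons last_rcons.
by rewrite cats1 finset.setUC.
Qed.

(** The mod 2 simplicial boundary of the 1-chain [A], evaluated at [w]: the parity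
of the degree of [w] in [A]. *)
Definition boundary A w : bool := \big[addb/false]_(e : {set G} | w \in e) (e \in A).

Lemma boundary_add (A B C : {set {set G}}) w :
  (forall e, (e \in C) = (e \in A) (+) (e \in B)) ->
  boundary C w = boundary A w (+) boundary B w.
Proof. by move=> h; rewrite /boundary -big_split /=; apply: eq_bigr => e _. Qed.

Lemma boundary_edge u v w : adj u v ->
  boundary [set [set u; v]] w = (w == u) (+) (w == v).
Proof.
move=> uv; rewrite /boundary (eq_bigr (fun e => e == [set u; v])); last first.
  by move=> e _; rewrite inE.
have -> : (w == u) (+) (w == v) = (w \in [set u; v]).
  rewrite !inE; case: eqP => // ->; case: eqP => // uv'.
  by move: uv; rewrite uv' adj_irrefl.
have [win|wn] := boolP (w \in [set u; v]).
  by rewrite (bigD1 [set u; v]) //= eqxx big1 // => e /andP[_ /negPf].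
by rewrite big1 // => e we; apply: contraNF wn => /eqP <-.
Qed.

Lemma boundary0 w : boundary finset.set0 w = false.
Proof. by rewrite /boundary big1 // => e _; rewrite inE. Qed.

Lemma odd_edges_cons u v p e :
  (e \in odd_edges u (v :: p)) = (e \in [set [set u; v]]) (+) (e \in odd_edges v p).
Proof. by rewrite !inE /= oddD oddb eq_sym. Qed.

Lemma boundary_walk u p w : path (@adj G) u p ->
  boundary (odd_edges u p) w = (w == u) (+) (w == last u p).
Proof.
elim: p u => [|v p IH] u /=.
  by move=> _; rewrite addbb -[RHS](boundary0 w); apply: eq_bigr => e _; rewrite !inE.
move=> /andP[uv vp]; rewrite (boundary_add _ (odd_edges_cons u v p)).
rewrite boundary_edge // IH //.
by case: (w == u); case: (w == v); case: (w == last v p).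
Qed.


Lemma boundaryT_edge A u : A \subset edges G -> boundary A u ->
  exists2 v, adj u v & [set u; v] \in A.
Proof.
move=> /fintype.subsetP sA bA.
have [e /andP[ue eA]|none] := pickP [pred e : {set G} | (u \in e) && (e \in A)].
  have [v uv E] := edges_inv (sA e eA) ue.
  by exists v; rewrite -?E.
move: bA; rewrite /boundary big1 // => e ue.
by have := none e; rewrite inE ue.
Qed.

(** A vertex of even degree in [A] is not a leaf of [A]. *)
Lemma boundaryF_edge A u v : A \subset edges G -> boundary A u = false ->
  [set u; v] \in A -> exists w, [/\ w != v, adj u w & [set u; w] \in A].
Proof.
move=> /fintype.subsetP sA bA uvA.
have [e /and3P[ue eA ne]|none] :=
  pickP [pred e : {set G} | [&& u \in e, e \in A & e != [set u; v]]].
  have [w uw E] := edges_inv (sA e eA) ue.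
  exists w; rewrite -E; split=> //.
  by apply: contraNneq ne => <-; rewrite E.
move: bA; rewrite /boundary (bigD1 [set u; v]) ?inE ?eqxx //= uvA big1 // => e.
by case/andP=> ue ne; have := none e; rewrite inE ue ne andbT.
Qed.

Lemma odd_edges_sub u p : {subset odd_edges u p <= walk_edges u p}.
Proof.
by move=> e; rewrite inE -has_pred1 has_count; case: (count _ _).
Qed.

Lemma odd_edges_cat u p q e :
  (e \in odd_edges u (p ++ q)) = (e \in odd_edges u p) (+) (e \in odd_edges (last u p) q).
Proof. by rewrite !inE /walk_edges pairmap_cat count_cat oddD. Qed.

(** The walk from [last u p] to [u] in question is [p] run backwards. *)
Lemma odd_edges_rev u p e :
  (e \in odd_edges (last u p) (rev (belast u p))) = (e \in odd_edges u p).
Proof. by rewrite !inE walk_edges_rev count_rev. Qed.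

Lemma odd_edges_uniq u p e : uniq (walk_edges u p) ->
  (e \in odd_edges u p) = (e \in walk_edges u p).
Proof. by move=> up; rewrite inE count_uniq_mem // oddb. Qed.

Lemma span_walk_edges A u p : path (span_adj A) u p ->
  {subset walk_edges u p <= A}.
Proof.
elim: p u => [|v p IH] u //= /andP[/andP[_ uvA] vp] e.
by rewrite inE => /orP[/eqP->|/IH->].
Qed.

Lemma span_cycle A p : @is_cycle (spanning_subgraph A) p -> @is_cycle G p.
Proof.
move=> /andP[sp /andP[cp up]]; rewrite /is_cycle /ucycleb sp up andbT /=.
by apply: sub_cycle cp => x y /andP[].
Qed.

End Walks.

(** In a set of edges with all degrees even no vertex is a leaf, so the subgraph with
these edges contains a cycle. *)
Lemma even_set_cycle (G : sgraph) (A : {set {set G}}) :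
  A \subset edges G -> A != finset.set0 ->
  (forall w, boundary A w = false) ->
  exists a p, [/\ path (@adj G) a p, last a p = a, uniq (walk_edges a p),
    {subset walk_edges a p <= A} & 0 < size p /\ girth G <= size p].
Proof.
move=> sA /finset.set0Pn[e0 e0A] bA.
have := fintype.subsetP sA e0 e0A.
rewrite inE => /existsP[a0 /existsP[b0 /andP[ab0 /eqP E0]]].
have [||s cs] := @cycle_of_no_leaf (spanning_subgraph A) a0 b0.
- by rewrite /= /span_adj ab0 -E0.
- move=> u v /andP[_ uvA].
  have [w [wv uw uwA]] := boundaryF_edge sA (bA u) uvA.
  by exists w; rewrite //= /span_adj uw.
have csG := span_cycle cs.
move: cs csG (girth_le_cycle csG) => /andP[+ /andP[+ _]] /andP[_ /andP[+ +]].
case: s => [|a s] //= ss cA cG uniqs gs.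
exists a, (rcons s a); split.
- exact: cG.
- by rewrite last_rcons.
- exact: cycle_edges_uniq.
- exact: span_walk_edges cA.
- by rewrite size_rcons.
Qed.

(** * Short walks with prescribed odd edges *)

(** The constant [1 + 2 / c] is the cost per edge of removing a cycle [C]: the detour
to [C] and back has length at most [2 * diam G <= (2 / c) * #|C|]. *)
Lemma walk_of_boundary (R : realFieldType) (c : R) (G : sgraph) :
  (0 < c)%R -> (forall u v : G, connect (@adj G) u v) ->
  (c * (diam G)%:R <= (girth G)%:R)%R ->
  forall (A : {set {set G}}) (u v : G), A \subset edges G ->
  (forall w, boundary A w = (w == u) (+) (w == v)) ->
  exists p, [/\ path (@adj G) u p, last u p = v, odd_edges u p = A &
    ((size p)%:R <= (1 + 2 / c) * #|A|%:R)%R].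
Proof.
move=> c0 conn hd A u v; move: {2}#|A|.+1 (ltnSn #|A|) => m.
have K0 : (0 < 2 / c)%R by rewrite divr_gt0.
elim: m A u => // m IH A u; rewrite ltnS => Am sA bA.
(* The induction removes edges of A and keeps the endpoint v. *)
have [uv|uv] := eqVneq u v; last first.
  have [|x ux uxA] := @boundaryT_edge _ A u sA.
    by rewrite bA eqxx (negPf uv).
  have cA : #|A| = #|A :\ [set u; x]|.+1 by rewrite (cardsD1 [set u; x] A) uxA.
  have inA e : (e \in A :\ [set u; x]) = (e \in A) (+) (e \in [set [set u; x]]).
    by rewrite !inE; case: eqP => [->|]; rewrite ?uxA ?addbF.
  have [||w|p [xp px pA sp]] := IH (A :\ [set u; x]) x.
  - by rewrite -cA.
  - by apply: fintype.subset_trans sA; exact: subsetDl.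
  - rewrite (boundary_add _ inA) bA boundary_edge //.
    by case: (w == u); case: (w == v); case: (w == x).
  - exists (x :: p); rewrite /= ux; split=> //.
      by apply/finset.setP => e; rewrite odd_edges_cons pA inA addbC addbK.
    rewrite cA -addn1 -[X in (_ <= _ * X%:R)%R]addn1 !natrD mulrDr mulr1.
    by rewrite lerD // lerDl ltW.
have bA0 w : boundary A w = false by rewrite bA uv addbb.
have [A0|An0] := eqVneq A finset.set0.
  by exists [::]; rewrite A0 cards0 mulr0 /= -uv; split=> //.
have [a [s [pas las us sC [s0 gs]]]] := even_set_cycle sA An0 bA0.
have [q [pq lq sq]] := gdist_walk (conn u a).
pose C := odd_edges a s.
have CE e : (e \in C) = (e \in walk_edges a s) by exact: odd_edges_uniq.
have CA : C \subset A by apply/fintype.subsetP => e; rewrite CE; exact: sC.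
have cC : #|C| = size s.
  rewrite -(size_pairmap (fun a b : G => [set a; b]) a s) -(card_uniqP us).
  exact: eq_card.
have cA : #|A| = #|A :\: C| + size s.
  by rewrite -cC addnC -(cardsID C A) (finset.setIidPr CA).
have inA e : (e \in A :\: C) = (e \in A) (+) (e \in C).
  rewrite inE; have := fintype.subsetP CA e.
  by case: (e \in C) => [->|_] //=; rewrite addbF.
have [||w|p [xp px pA sp]] := IH (A :\: C) u.
- by apply: leq_trans Am; rewrite cA -[X in X < _]addn0 ltn_add2l.
- by apply: fintype.subset_trans sA; exact: subsetDl.
- by rewrite (boundary_add _ inA) bA boundary_walk // las addbb addbF.
have lback : last a (rev (belast u q)) = u.
  case: q lq {pq sq} => [|x q] /=; first by move=> ->.
  by move=> _; rewrite rev_cons last_rcons.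
(* The edges of q are run through in both directions, so they cancel. *)
exists (q ++ s ++ rev (belast u q) ++ p); split.
- rewrite !cat_path pq lq pas las lback xp andbT /=.
  rewrite -{1}lq rev_path; apply: sub_path pq => x y; by rewrite adj_sym.
- by rewrite !last_cat lq las lback.
- apply/finset.setP => e; rewrite !odd_edges_cat lq las lback pA inA -{2}lq odd_edges_rev.
  rewrite -/C; by case: (e \in odd_edges u q); case: (e \in A); case: (e \in C).
rewrite !size_cat size_rev size_belast cA !natrD sq.
have dd : ((gdist u a)%:R <= c^-1 * (size s)%:R :> R)%R.
  rewrite ler_pdivlMl //; apply: le_trans (_ : (girth G)%:R <= _)%R; last first.
    by rewrite ler_nat.
  by apply: le_trans hd; rewrite ler_pM2l // ler_nat gdist_le_diam.
move: sp dd; set K := ((size s)%:R)%R; set L := (#|_|%:R)%R => sp dd.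
rewrite mulrDr; lra.
Qed.

(** * Walls in the lift *)

Section Walls.
Variables (G : sgraph) (T : {set {set G}}).
Hypothesis treeT : spanning_tree T.
Variable root : G.
Implicit Types (u v w : G) (e : {set G}) (f h : labeling T).

(** For an edge [e] of the tree this is the identity, so that the two kinds of edges
of the lift are described by one formula, see [lift_adjE]. *)
Definition flip e f : labeling T := [ffun s => f s (+) (val s == e)].

Lemma cotreeN (s : {e : {set G} | e \in cotree T}) : val s \notin T.
Proof. by have := valP s; rewrite inE => /andP[]. Qed.

Lemma flip_tree e f : e \in T -> flip e f = f.
Proof.
move=> eT; apply/ffunP => s; rewrite ffunE.
by case: eqP (cotreeN s) => [->|_ _]; rewrite ?eT ?addbF.
Qed.

Lemma lift_adjE (x y : lift_graph T) :
  adj x y = adj x.1 y.1 && (y.2 == flip [set x.1; y.1] x.2).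
Proof.
rewrite [LHS]/= /lift_adj; congr (_ && _).
case: ifP => [eT|_]; first by rewrite flip_tree // eq_sym.
apply/forallP/eqP => [E|-> s].
  by apply/ffunP => s; rewrite ffunE (eqP (E s)); case: ifP; rewrite ?addbT ?addbF.
by rewrite ffunE; case: ifP; rewrite ?addbT ?addbF.
Qed.

(** For an edge [e] of the tree, [T :\ e] has two components; [side e] is the
indicator of the one that contains [root]. *)
Definition side e u : bool := connect (span_adj (T :\ e)) root u.

(** If both ends of [e] were on the side of the root, then [e] would close a cycle in
the tree; if neither were, then this side would be closed under adjacency in the
tree, which is connected. *)
Lemma side_tree_step e u v : adj u v -> [set u; v] \in T ->
  side e v = side e u (+) (e == [set u; v]).
Proof.
move=> uv uvT; have [_ [[_ connT] acycT]] := treeT.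
have symD : connect_sym (span_adj (T :\ e)).
  by apply: sym_connect_sym; exact: span_adj_sym.
have [E|ne] := eqVneq e [set u; v]; last first.
  rewrite addbF; apply/esym/(same_connect_r symD)/connect1.
  by rewrite /span_adj uv !inE eq_sym ne uvT.
rewrite addbT; have [su|su] /= := boolP (side e u).
  apply/negP => sv; have : connect (span_adj (T :\ e)) u v.
    by apply: connect_trans sv; rewrite symD.
  move=> /connectP[p0 /shortenP[p pp up _] lp].
  have {}pp' : path (span_adj T) u p.
    apply: sub_path pp => a b /andP[ab]; rewrite inE => /andP[_ abT].
    by rewrite /span_adj ab.
  have /negP[] := acycT (u :: p); rewrite /is_cycle /ucycleb up andbT /=.
  rewrite rcons_path pp' -lp /= span_adj_sym {1}/span_adj uv uvT /=.
  case: p lp pp {up pp'} => [|a [|b p]] //= lp; first by move: uv; rewrite lp adj_irrefl.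
  by rewrite -lp /span_adj !inE E eqxx !andbF.
apply: contraT => sv.
have clos : fingraph.closed (span_adj T) [pred w | side e w].
  apply: intro_closed; first by apply: sym_connect_sym; exact: span_adj_sym.
  move=> a b /andP[ab abT]; rewrite !inE => sa.
  apply: (connect_trans sa); apply: connect1; rewrite /span_adj ab !inE abT andbT.
  apply/eqP => abE; have : a \in [set u; v] by rewrite -E -abE !inE eqxx.
  by rewrite !inE => /orP[] /eqP aE; move: sa; rewrite aE ?(negPf su) ?(negPf sv).
by have := closed_connect clos (connT root u); rewrite !inE (negPf su) /side connect0.
Qed.

(** For an edge [e'], this says that its two ends are on different sides of [e]; the
sum over the ends makes it independent of their order. *)
Definition crosses e e' : bool := \big[addb/false]_(w in e') side e w.

Lemma crossesE e u v : adj u v -> crosses e [set u; v] = side e u (+) side e v.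
Proof.
move=> uv; rewrite /crosses big_setU1 /= ?big_set1 // inE.
by apply: contraTneq uv => ->; rewrite adj_irrefl.
Qed.

(** For a cotree edge, its coordinate in the labeling changes exactly when the edge is
crossed.  For a tree edge, [side e] also changes along the cotree edges that
cross the cut of [T :\ e]; the sum of their coordinates changes at the same time
and compensates for this. *)
Definition wall e (x : lift_graph T) : bool :=
  if e \in T then side e x.1 (+) \big[addb/false]_(s | crosses e (val s)) x.2 s
  else oapp x.2 false (insub e).

Lemma wall_step e (x y : lift_graph T) : adj x y ->
  wall e y = wall e x (+) (e == [set x.1; y.1]).
Proof.
case: x y => [u f] [v h]; rewrite lift_adjE => /andP[/= uv /eqP ->].
rewrite /wall; case: ifP => [eT|/negbT eT]; last first.
  case: insubP => [s _ <-|ec] /=; first by rewrite ffunE.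
  case: eqP => // E; move: ec; rewrite E in eT *.
  by rewrite inE eT adj_edges.
rewrite [X in _ (+) X](eq_bigr (fun s => f s (+) (val s == [set u; v]))); last first.
  by move=> s _; rewrite ffunE.
rewrite big_split /=.
have [uvT|uvT] := boolP ([set u; v] \in T).
  rewrite (side_tree_step e uv uvT) [X in _ (+) (_ (+) X)]big1 => [|s _].
    by rewrite addbF addbAC.
  by move: (cotreeN s) => /=; case: eqP => // ->; rewrite uvT.
have uvc : [set u; v] \in cotree T by rewrite inE uvT adj_edges.
have -> : (e == [set u; v]) = false by apply: contraNF uvT => /eqP <-.
have -> : \big[addb/false]_(s : {e : {set G} | e \in cotree T} | crosses e (val s))
    (val s == [set u; v]) = crosses e [set u; v].
  have [c|c] := boolP (crosses _ _).
    pose s0 : {e : {set G} | e \in cotree T} := Sub [set u; v] uvc.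
    rewrite (bigD1 s0) //= eqxx big1 // => s /andP[_ ns].
    by apply: contraNF ns => E; rewrite -val_eqE.
  by rewrite big1 // => s cs; case: eqP c => // <-; rewrite cs.
by rewrite crossesE //; case: (side e u); case: (side e v); case: (bigop _ _ _).
Qed.

Lemma wall_walk e (x : lift_graph T) p : path (@adj (lift_graph T)) x p ->
  path (@adj G) x.1 (map fst p) /\
  wall e (last x p) = wall e x (+) (e \in odd_edges x.1 (map fst p)).
Proof.
elim: p x => [|y p IH] x /=; first by rewrite inE addbF.
move=> /andP[xy /IH[pp ->]]; have -> : adj x.1 y.1 by have /andP[] := xy.
by split=> //; rewrite odd_edges_cons (wall_step e xy) -addbA !inE.
Qed.

Lemma lift_walk (x : lift_graph T) p : path (@adj G) x.1 p ->
  exists2 q, path (@adj (lift_graph T)) x q & map fst q = p.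
Proof.
elim: p x => [|v p IH] x /=; first by exists [::].
move=> /andP[xv vp].
have xy : @adj (lift_graph T) x (v, flip [set x.1; v] x.2).
  by rewrite lift_adjE /= xv eqxx.
have [q yq E] := IH (v, flip [set x.1; v] x.2) vp.
exists ((v, flip [set x.1; v] x.2) :: q); last by rewrite /= E.
by apply/andP.
Qed.

Lemma wall_inj (x y : lift_graph T) :
  x.1 = y.1 -> (forall e, wall e x = wall e y) -> x = y.
Proof.
case: x y => [u f] [v h] /= <- E; congr pair; apply/ffunP => s.
by have := E (val s); rewrite /wall (negPf (cotreeN s)) valK.
Qed.

(** Moving along the tree leaves the labeling fixed, so one coordinate of the labeling
can be changed at a time: go to the corresponding cotree edge, cross it and come
back. *)
Lemma lift_connected (x y : lift_graph T) : connect (@adj (lift_graph T)) x y.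
Proof.
have [subT [[_ connT] _]] := treeT.
have tree u v f : connect (@adj (lift_graph T)) (u, f) (v, f).
  have /connectP[p] := connT u v; elim: p u => [|w p IH] u /=.
    by move=> _ ->; exact: connect0.
  move=> /andP[/andP[uw uwT] wp] lp; apply: connect_trans (IH w wp lp).
  by apply: connect1; rewrite lift_adjE /= uw flip_tree // eqxx.
have switch u f e : e \in cotree T ->
    connect (@adj (lift_graph T)) (u, f) (u, flip e f).
  rewrite inE => /andP[_]; rewrite inE => /existsP[a /existsP[b /andP[ab /eqP E]]].
  apply: connect_trans (tree u a f) _; apply: connect_trans (tree b u _).
  by apply: connect1; rewrite lift_adjE /= ab /= E.
case: x y => [u f] [v h]; apply: connect_trans (tree u v h).
(* Agrees with h on ss and with f elsewhere. *)
pose mix (ss : seq {e : {set G} | e \in cotree T}) : labeling T :=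
  [ffun s => if s \in ss then h s else f s].
have -> : h = mix (enum {: {e : {set G} | e \in cotree T}}).
  by apply/ffunP => s; rewrite ffunE mem_enum.
elim: (enum _) => [|s ss IH].
  have -> : mix [::] = f by apply/ffunP => s; rewrite ffunE.
  exact: connect0.
have [E|ne] := eqVneq (mix (s :: ss)) (mix ss); first by rewrite E.
apply: connect_trans IH _; suff -> : mix (s :: ss) = flip (val s) (mix ss).
  by apply: switch; exact: valP.
apply/ffunP => t; rewrite !ffunE inE val_eqE.
have [->|] := eqVneq t s; last by rewrite addbF.
have : mix (s :: ss) s != mix ss s.
  apply: contraNneq ne => E; apply/eqP/ffunP => t'.
  have [->//|t's] := eqVneq t' s.
  by rewrite !ffunE inE (negPf t's).
by rewrite !ffunE inE eqxx /=; case: (h s); case: (if _ then _ else _).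
Qed.

Definition separating (x y : lift_graph T) : {set {set G}} :=
  [set e | wall e x != wall e y].

Lemma separating_walk x p : path (@adj (lift_graph T)) x p ->
  separating x (last x p) = odd_edges x.1 (map fst p).
Proof.
move=> xp; apply/finset.setP => e; rewrite inE.
by have [_ ->] := wall_walk e xp; case: (wall e x); case: (e \in _).
Qed.

Lemma card_separating_le x y : #|separating x y| <= gdist x y.
Proof.
have [p [pp <- <-]] := gdist_walk (lift_connected x y).
rewrite separating_walk // -(size_map fst p).
rewrite -(size_pairmap (fun a b : G => [set a; b]) x.1).
apply: leq_trans (card_size _); apply: subset_leq_card.
apply/fintype.subsetP => e; exact: odd_edges_sub.
Qed.

(** A walk in [G] whose odd edges are those that separate [x] from [y] lifts to a walk
from [x] to [y]: all walls of its endpoint agree with those of [y]. *)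
Lemma gdist_le_separating (R : realFieldType) (c : R) x y :
  (0 < c)%R -> (forall u v : G, connect (@adj G) u v) ->
  (c * (diam G)%:R <= (girth G)%:R)%R ->
  ((gdist x y)%:R <= (1 + 2 / c) * #|separating x y|%:R)%R.
Proof.
move=> c0 conn hd.
have [p0 [xp0 lp0 _]] := gdist_walk (lift_connected x y).
have sE := separating_walk xp0; rewrite lp0 in sE.
have [xp0' _] := wall_walk finset.set0 xp0.
have l0 : last x.1 (map fst p0) = y.1 by rewrite last_map lp0.
have [||p [xp lp pE sp]] :=
    @walk_of_boundary R c G c0 conn hd (separating x y) x.1 y.1.
- rewrite sE; apply/fintype.subsetP => e /odd_edges_sub.
  exact: walk_edges_sub.
- by move=> w; rewrite sE boundary_walk // l0.
have [q xq qE] := lift_walk xp.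
apply: le_trans sp; rewrite ler_nat -qE size_map.
suff -> : y = last x q by exact: gdist_le_walk.
apply: wall_inj; first by rewrite -lp -qE last_map.
move=> e; have [_ ->] := wall_walk e xq; rewrite qE pE inE.
by case: (wall e x); case: (wall e y).
Qed.

End Walls.

Local Open Scope classical_set_scope.
Local Open Scope ring_scope.

(** * Embedding finite sequences into the space of summable sequences *)

Section Ell1.
Variable R : realType.

Lemma cvg_normed_series_finite (u : R^nat) (N : nat) :
  (forall k, (N <= k)%N -> u k = 0) ->
  [normed series u] @ \oo --> \sum_(0 <= k < N) `|u k|.
Proof.
move=> u0; apply: cvg_near_cst; near=> n.
have Nn : (N <= n)%N by near: n; exact: nbhs_infty_ge.
have -> : [normed series u] n = \sum_(0 <= k < n) `|u k| by [].
rewrite (big_cat_nat _ Nn) //= [X in _ + X]big_nat [X in _ + X]big1 ?addr0 // => k.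
by move=> /andP[Nk _]; rewrite u0 // normr0.
Unshelve. all: by end_near. Qed.

Lemma seq_ell1_cvg (s : seq R) : cvgn [normed series (nth 0 s : R^nat)].
Proof.
apply/cvg_ex; eexists; apply: (@cvg_normed_series_finite _ (size s)) => k.
exact: nth_default.
Qed.

Definition seq_ell1 (s : seq R) : ell1 :=
  exist (fun u : R^nat => cvgn [normed series u]) _ (@seq_ell1_cvg s).

Lemma ell1_dist_map (F : finType) (f g : F -> R) :
  ell1_dist (seq_ell1 (map f (enum F))) (seq_ell1 (map g (enum F))) =
  \sum_(e : F) `|f e - g e|.
Proof.
rewrite /ell1_dist; apply: cvg_lim => //.
have -> : \sum_(e : F) `|f e - g e| = \sum_(0 <= k < size (enum F))
    `|nth 0 (map f (enum F)) k - nth 0 (map g (enum F)) k|.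
  rewrite -big_enum /=; elim: (enum F) => [|e s IH]; first by rewrite big_nil big_geq.
  by rewrite big_cons big_nat_recl //= IH.
apply: cvg_normed_series_finite => k sk.
have zero (h : F -> R) : nth 0 (map h (enum F)) k = 0.
  by rewrite nth_default // size_map.
by rewrite -[LHS]/(nth 0 (map f (enum F)) k - nth 0 (map g (enum F)) k) !zero subr0.
Qed.

Lemma c1_le (X : Type) (dX : X -> X -> R) (f : X -> ell1) (r C : R) :
  injective f -> 0 < r ->
  (forall u v, r * dX u v <= ell1_dist (f u) (f v) <= r * C * dX u v) ->
  (c1 dX <= C%:E)%E.
Proof.
move=> injf r0 bounds; apply: (@le_trans _ _ (distortion dX ell1_dist f)).
  by apply: ereal_inf_lbound; exists f.
by apply: ereal_inf_lbound; exists C => //; exists r.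
Qed.

End Ell1.

(** * Bounded distortion of the lifts *)

Theorem theorem5 (R : realType) (k : nat) (hk : (3 <= k)%N)
    (G : nat -> sgraph)
    (hconn : forall n, gconnected (G n))
    (hreg : forall n, regular (G n) k)
    (hgirth : (fun n => girth (G n)) @ \oo --> \oo)
    (hdiam : exists2 c : R, 0 < c &
       forall n, c * (diam (G n))%:R <= (girth (G n))%:R)
    (T : forall n, {set {set G n}})
    (hT : forall n, spanning_tree (T n)) :
  exists D : R, forall n, (c1_graph R (lift_graph (T n)) <= D%:E)%E.
Proof.
have [c c0 hc] := hdiam; pose K : R := 1 + 2 / c.
have K0 : 0 < K by rewrite /K addr_gt0 // divr_gt0.
exists K => n.
have [/card_gt0P[root _] conn] := hconn n.
have upper x y := gdist_le_separating (hT n) root x y c0 conn (hc n).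
pose f (x : lift_graph (T n)) : ell1 :=
  seq_ell1 [seq (wall root e x)%:R : R | e <- enum {set (G n)}].
have df x y : ell1_dist (f x) (f y) = #|separating root x y|%:R.
  rewrite ell1_dist_map -sum1_card natr_sum [RHS]big_mkcond /=; apply: eq_bigr => e _.
  rewrite inE; case: (wall root e x); case: (wall root e y) => /=;
    by rewrite ?subrr ?subr0 ?sub0r ?normrN ?normr0 ?normr1.
(* With scaling factor 1/K the two bounds read d/K <= #|A| <= d. *)
apply: (@c1_le _ _ _ f K^-1) => [x y fxy||x y].
- have d0 : gdist x y = 0%N.
    apply/eqP; rewrite -leqn0 -(ler_nat R); apply: le_trans (upper x y) _.
    rewrite -df fxy df; suff -> : separating root y y = finset.set0.
      by rewrite cards0 mulr0.
    by apply/finset.setP => e; rewrite !inE eqxx.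
  have [p [_ lp dp]] := gdist_walk (lift_connected (hT n) x y).
  by rewrite -lp (size0nil (etrans dp d0)).
- by rewrite invr_gt0.
rewrite df mulVf ?gt_eqF // mul1r ler_nat card_separating_le ?andbT //.
by rewrite ler_pdivrMl // upper.
Qed.
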